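(* For all integers $n,k$ with $1\le k\le n-1$, $$I_{n,k}=I_{n,k-1}+C_k\sum_{i=0}^{n-k} I_{i,k-1}\,U_{n-k-i,k}\qquad\text{and}\qquad U_{n,k}=U_{n,k-1}+\sum_{i=0}^{n-k}U_{i,k-1}\,C_k\,U_{n-k-i,k}.$$
   Context: $C_m=\frac{1}{m+1}\binom{2m}{m}$ is the $m$-th Catalan number. Parking rules: $n$ spots $1,\dots,n$; cars $c_1,\dots,c_n$ arrive in order with preferences $a_j\in[n]$; $k$-Naples rule: $c_j$ parks at $a_j$ if empty, otherwise checks spots $a_j-1,\dots,a_j-k$ (those $\ge1$) in order and parks in the first empty one, otherwise drives forward from $a_j$ and parks in the first empty spot after $a_j$ (failing if none). A preference is a $k$-Naples parking function if all cars park; $0$-Naples parking functions are ordinary parking functions. $I_{n,k}$ is the number of ascending (weakly increasing) $k$-Naples parking functions of length $n$, and $U_{n,k}$ is the number of those whose first entry is $1$. Conventions: $I_{n,0}=C_n$ for $n\ge0$ (in particular the empty sequence counts once, so $I_{0,k}=1$), $U_{n,0}=C_n$ for $n\ge1$, and $U_{0,k}=0$ for all $k\ge0$. *)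

(* Defs.v *)
From mathcomp Require Import all_boot.

Set Implicit Arguments.
Unset Strict Implicit.
Unset Printing Implicit Defensive.

(* The division is exact. *)
Definition catalan (m : nat) : nat := 'C(2 * m, m) %/ m.+1.

(* Spots are the naturals 1, ..., n.  The spots a car with preference a examines,
   in the order it examines them: a, then a - 1, ..., a - k (those >= 1), then
   a + 1, ..., n.  The car parks in the first empty one, and fails to park if
   none of them is empty. *)
Definition naples_route (n k a : nat) : seq nat :=
  a :: [seq a - i | i <- iota 1 k & i < a] ++ iota a.+1 (n - a).

Definition naples_spot (n k : nat) (occ : seq nat) (a : nat) : option nat :=
  ohead [seq x <- naples_route n k a | x \notin occ].

(* occ lists the spots that are already occupied. *)
Fixpoint all_park (n k : nat) (occ s : seq nat) : bool :=
  if s is a :: s' then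
    if naples_spot n k occ a is Some x then all_park n k (x :: occ) s' else false
  else true.

(* Here j : 'I_n stands for the spot j + 1. *)
Definition prefs (n : nat) (t : n.-tuple 'I_n) : seq nat :=
  [seq (nat_of_ord j).+1 | j <- t].

Definition naples_parking (n k : nat) (t : n.-tuple 'I_n) : bool :=
  all_park n k [::] (prefs t).

Definition ascending (n : nat) (t : n.-tuple 'I_n) : bool :=
  sorted leq (prefs t).

Definition I_count (n k : nat) : nat :=
  #|[set t : n.-tuple 'I_n | ascending t && naples_parking k t]|.

(* The empty sequence has no first entry, so U_count 0 k = 0. *)
Definition U_count (n k : nat) : nat :=
  #|[set t : n.-tuple 'I_n |
      [&& ascending t, naples_parking k t & ohead (prefs t) == Some 1]]|.

Lemma I_count0 (k : nat) : I_count 0 k = 1.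
Proof.
rewrite /I_count (_ : [set t | _] = [set: 0.-tuple 'I_0]) ?cardsT ?card_tuple //.
by apply/setP=> t; rewrite !inE tuple0.
Qed.

Lemma U_count0 (k : nat) : U_count 0 k = 0.
Proof. by apply/eqP; rewrite cards_eq0; apply/eqP/setP=> t; rewrite !inE tuple0. Qed.

(* Main.v *)
(* Let S_j be the number of cars with preference at most j, and call S_j - j the
   level at j.  When cars arrive in ascending order, a run of r consecutive
   negative levels starting at spot l leaves l empty until a car with
   preference l + r arrives, so an ascending preference is k-Naples iff every
   maximal run of negative levels has length at most k.

   A run of length t can be chosen in catalan t ways and is followed by a
   preference starting with 1, while a preference starting with 1 splits at its
   first return to level 0 into a 0-Naples preference, up to a shift of the
   levels, and an arbitrary one.  For the generating functions this reads
     I_k = 1 + P_k U_k,   U_k = X I_0 I_k,   P_k = \sum_(t <= k) catalan t X^t.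
   Expanding either factor of I_(k-1) I_k with the first equation and
   cancelling P_(k-1) X I_0 I_(k-1) I_k gives
     I_k = I_(k-1) + catalan k X^k I_(k-1) U_k,
   and multiplying by X I_0 gives the identity for U_k. *)
Require Import Defs.
From mathcomp Require Import all_boot all_algebra.
From mathcomp Require Import zify ring.

Set Implicit Arguments.
Unset Strict Implicit.
Unset Printing Implicit Defensive.

Lemma iota_cat_cons i n x : i <= x < i + n ->
  iota i n = iota i (x - i) ++ x :: iota x.+1 (i + n - x.+1).
Proof.
move=> ixn; have -> : n = (x - i) + (i + n - x.+1).+1 by lia.
by rewrite iotaD subnKC /=; [congr (_ ++ _ :: iota _ _)|]; lia.
Qed.

Lemma ohead_filter_cat (T : eqType) (p : pred T) s1 x s2 :
  {in s1, forall y, ~~ p y} -> p x -> ohead [seq y <- s1 ++ x :: s2 | p y] = Some x.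
Proof.
move=> s1p px; rewrite filter_cat /= px (_ : filter p s1 = [::]) //.
by apply/eqP; rewrite -(negbK (_ == _)) -has_filter; apply/hasPn.
Qed.

Section NaplesSpot.

Variables (n k : nat) (occ : seq nat).

Lemma mem_naples_route a x : 0 < a <= n ->
  (x \in naples_route n k a) = (0 < x <= n) && (a <= x + k).
Proof.
move=> an; rewrite in_cons mem_cat mem_iota; apply/or3P/idP => [[/eqP->|/mapP[i]|]|xn].
- by lia.
- by rewrite mem_filter mem_iota => ik ->; lia.
- by lia.
case: (ltngtP x a) => xa; last by constructor 1.
  by constructor 2; apply/mapP; exists (a - x); rewrite ?mem_filter ?mem_iota; lia.
by constructor 3; lia.
Qed.

Lemma naples_spot_Some a x : 0 < a <= n ->
  naples_spot n k occ a = Some x -> [/\ x \notin occ, 0 < x <= n & a <= x + k].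
Proof.
move=> an; rewrite /naples_spot => eq_x.
have: x \in [seq y <- naples_route n k a | y \notin occ].
  by case: (filter _ _) eq_x => //= y t [->]; rewrite mem_head.
by rewrite mem_filter mem_naples_route // => /and3P[].
Qed.

Lemma naples_spot_backward a x : 0 < x <= a -> a <= x + k ->
  x \notin occ -> {subset iota x.+1 (a - x) <= occ} -> naples_spot n k occ a = Some x.
Proof.
move=> xa axk x_free occ_above; rewrite /naples_spot /naples_route.
have [ax|a_neq_x] := eqVneq a x; first by rewrite /= ax x_free.
rewrite (@iota_cat_cons 1 k (a - x)); last by lia.
have lt_ax_a : a - x < a by lia.
rewrite filter_cat map_cat [filter _ (_ :: _)]/= lt_ax_a map_cons subKn; last by lia.
rewrite -catA cat_cons -cat_cons.
apply: (ohead_filter_cat (p := fun y => y \notin occ)) => // y.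
rewrite negbK in_cons => /orP[/eqP->|/mapP[i]].
  by apply: occ_above; rewrite mem_iota; lia.
by rewrite mem_filter mem_iota => i_lt ->; apply: occ_above; rewrite mem_iota; lia.
Qed.

Lemma naples_spot_forward a x : 0 < a < x -> x <= n ->
  x \notin occ -> {subset iota 1 x.-1 <= occ} -> naples_spot n k occ a = Some x.
Proof.
move=> ax xn x_free occ_below; rewrite /naples_spot /naples_route.
rewrite (@iota_cat_cons a.+1 (n - a) x); last by lia.
rewrite catA -cat_cons.
apply: (ohead_filter_cat (p := fun y => y \notin occ)) => // y.
rewrite negbK in_cons mem_cat mem_iota => y_before; apply: occ_below; rewrite mem_iota.
case/or3P: y_before => [/eqP->|/mapP[i]|]; first by lia.
  by rewrite mem_filter mem_iota => i_lt ->; lia.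
by lia.
Qed.

End NaplesSpot.

Lemma all_park_cons n k occ a x s : naples_spot n k occ a = Some x ->
  all_park n k occ (a :: s) = all_park n k (x :: occ) s.
Proof. by move=> /= ->. Qed.

(* The n cars fill all n spots, and the one that takes h backs up by at most k. *)
Lemma all_park_covers n k h occ s : 0 < h <= n -> h \notin occ ->
  uniq occ -> {subset occ <= iota 1 n} -> all (fun a => 0 < a <= n) s ->
  size occ + size s = n -> all_park n k occ s -> has (fun a => a <= h + k) s.
Proof.
move=> hn; elim: s occ => [|a s IHs] occ h_free occ_uniq occ_n /=.
  rewrite addn0 => _ size_occ _; have [|_ occE] := uniq_min_size occ_uniq occ_n.
    by rewrite size_iota size_occ.
  by move: h_free; rewrite occE mem_iota; lia.
case/andP=> an sn size_total; case spot_x: naples_spot => [x|] // park_s.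
have [x_free xn axk] := naples_spot_Some an spot_x.
have [<-|x_neq_h] := eqVneq x h; first by rewrite axk.
rewrite (IHs (x :: occ)) ?orbT //=; last by lia.
- by rewrite in_cons negb_or eq_sym x_neq_h.
- by rewrite x_free.
by move=> y; rewrite in_cons mem_iota => /predU1P[->|/occ_n]; rewrite ?mem_iota; lia.
Qed.

Definition full (occ : seq nat) : bool := perm_eq occ (iota 1 (size occ)).

Definition holed (h a : nat) (occ : seq nat) : Prop :=
  [/\ uniq occ, {subset occ <= iota 1 a}, {subset iota 1 h.-1 <= occ} & h \notin occ].

(* The street while the cars with preference a arrive, those with smaller
   preferences having parked; r is the length of the run of negative levels that
   ends at a - 1. *)
Definition street (r a : nat) (occ : seq nat) : Prop :=
  full occ /\ a <= size occ \/ r < a /\ holed (a - r) a occ.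

Lemma street_nil : street 0 1 [::].
Proof. by right; split=> //; split. Qed.

Lemma size_holed h a occ : 0 < h <= a -> holed h a occ -> size occ < a.
Proof.
move=> ha [occ_uniq occ_a _ h_free]; rewrite -(size_iota 1 a).
apply: (@uniq_leq_size _ (h :: occ)) => [|x]; first by rewrite /= h_free.
by rewrite in_cons => /predU1P[->|/occ_a //]; rewrite mem_iota; lia.
Qed.

Lemma mem_full occ : full occ -> forall x, (x \in occ) = (0 < x <= size occ).
Proof. by move=> /perm_mem occE x; rewrite occE mem_iota. Qed.

Lemma full_park n k a occ : full occ -> 0 < a <= size occ -> size occ < n ->
  naples_spot n k occ a = Some (size occ).+1 /\ full ((size occ).+1 :: occ).
Proof.
move=> occ_full a_occ size_n; split.
  apply: naples_spot_forward => // [|x]; first by rewrite mem_full //; lia.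
  by rewrite mem_iota mem_full //; lia.
have iota_rcons : iota 1 (size occ).+1 = rcons (iota 1 (size occ)) (size occ).+1.
  by rewrite -(addn1 (size occ)) iotaD cats1 addnC.
by rewrite /full [size _]/= iota_rcons perm_sym perm_rcons perm_cons perm_sym.
Qed.

Lemma holed_park n k h a occ : 0 < h <= a -> a <= h + k -> holed h a occ ->
  exists2 x, naples_spot n k occ a = Some x &
    full (x :: occ) /\ size (x :: occ) = a \/ holed h a (x :: occ).
Proof.
move=> ha ahk [occ_uniq occ_a occ_h h_free].
have ex_free : exists x, (x <= a) && (x \notin occ) by exists h; rewrite h_free; lia.
have le_a x : (x <= a) && (x \notin occ) -> x <= a by case/andP.
case: (ex_maxnP ex_free le_a) => x /andP[xa x_free] x_max.
have hx : h <= x by apply: x_max; rewrite h_free; lia.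
have occ_above : {subset iota x.+1 (a - x) <= occ}.
  move=> y; rewrite mem_iota => xya; apply/negPn/negP => y_free.
  by have := x_max y; rewrite y_free andbT => /(_ _); lia.
exists x; first by apply: naples_spot_backward => //; lia.
have occ'_uniq : uniq (x :: occ) by rewrite /= x_free.
have occ'_a : {subset x :: occ <= iota 1 a}.
  by move=> y; rewrite in_cons => /predU1P[->|/occ_a //]; rewrite mem_iota; lia.
have [xh|x_neq_h] := eqVneq x h; [left|right]; last first.
  split=> // [y /occ_h y_occ|]; first by rewrite in_cons y_occ orbT.
  by rewrite in_cons negb_or eq_sym x_neq_h.
have perm_a : perm_eq (x :: occ) (iota 1 a).
  apply: uniq_perm => // [|y]; first exact: iota_uniq.
  apply/idP/idP => [/occ'_a //|]; rewrite mem_iota in_cons => ya.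
  case: (ltngtP y x) => //= [yx|xy]; first by apply: occ_h; rewrite mem_iota; lia.
  by apply: occ_above; rewrite mem_iota; lia.
by rewrite /full (perm_size perm_a) size_iota.
Qed.

Lemma street_park n k r a occ : street r a occ -> r <= k ->
  0 < a <= n -> size occ < n ->
  exists2 x, naples_spot n k occ a = Some x & street r a (x :: occ).
Proof.
move=> [[occ_full a_occ]|[ra occ_holed]] rk an size_n.
  have a_filled : 0 < a <= size occ by lia.
  have [spot_x full_x] := full_park k occ_full a_filled size_n.
  by exists (size occ).+1 => //; left; split=> //=; lia.
have [hole_a reach_hole] : 0 < a - r <= a /\ a <= a - r + k by lia.
have [x spot_x occ'] := holed_park n hole_a reach_hole occ_holed.
by exists x => //; case: occ' => [[full_x size_x]|]; [left; rewrite size_x|right].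
Qed.

Lemma street_advance r a occ : street r a occ ->
  street (if size occ < a then r.+1 else 0) a.+1 occ.
Proof.
move=> [[occ_full a_occ]|[ra occ_holed]].
  rewrite ltnNge a_occ /=; case: (ltngtP a (size occ)) a_occ => // [a_lt|aE] _.
    by left.
  right; split=> //; have occE := mem_full occ_full.
  split=> [|x|x|]; rewrite ?occE ?mem_iota -?aE; try by lia.
  by rewrite (perm_uniq occ_full) iota_uniq.
rewrite (size_holed _ occ_holed); last by lia.
right; split=> //; rewrite subSS; have [occ_uniq occ_a occ_h h_free] := occ_holed.
by split=> // x /occ_a; rewrite !mem_iota; lia.
Qed.

Lemma street_stuck n k r a occ s : street r a occ -> size occ < a <= n -> k <= r ->
  size occ + size s = n -> all (fun b => a < b <= n) s -> all_park n k occ s = false.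
Proof.
move=> [[_ a_occ]|[ra [occ_uniq occ_a _ h_free]]] occ_lt kr size_total range_s.
  by lia.
apply/negP => /(all_park_covers (h := a - r)) reach.
have /hasP[b /(allP range_s)] : has (fun b => b <= a - r + k) s; last by lia.
apply: reach => //; first by lia.
  by move=> x /occ_a; rewrite !mem_iota; lia.
by apply: sub_all range_s => b; lia.
Qed.

Fixpoint ascents (m j : nat) : nat -> seq (seq nat) :=
  if m is m'.+1 then
    fix ascents_m (q : nat) : seq (seq nat) :=
      if q is q'.+1 then [seq j.+1 :: s | s <- ascents_m q'] ++ ascents m' j.+1 q
      else [:: [::]]
  else fun q => if q is 0 then [:: [::]] else [::].

Lemma ascentsSS m j q :
  ascents m.+1 j q.+1 = [seq j.+1 :: s | s <- ascents m.+1 j q] ++ ascents m j.+1 q.+1.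
Proof. by []. Qed.

Lemma mem_ascents m j q s : (s \in ascents m j q) =
  [&& sorted leq s, size s == q & all (fun a => j < a <= j + m) s].
Proof.
elim: m j q s => [|m IHm] j q s.
  have no_room a : (j < a <= j + 0) = false by lia.
  by case: s q => [|a s] [|q]; rewrite ?inE ?in_nil /= ?no_room ?andbF.
elim: q s => [|q IHq] s; first by case: s => [|a s]; rewrite ?andbF.
rewrite ascentsSS mem_cat IHm; case: s => [|a s].
  by rewrite orbF; apply/mapP => -[].
rewrite [sorted _ _]/= (path_sortedE leq_trans) [size _]/= eqSS ![all _ (a :: s)]/=.
have [->|a_neq] := eqVneq a j.+1.
  rewrite (mem_map (can_inj (g := behead) _)) // IHq ltnn !andbF orbF.
  have [range_s|] := boolP (all (fun b => j < b <= j + m.+1) s); rewrite ?andbF //.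
  have -> : all (leq j.+1) s by apply: sub_all range_s => b; lia.
  by have -> : j < j.+1 <= j + m.+1 by lia; rewrite andbT.
have /negPf -> : a :: s \notin [seq j.+1 :: t | t <- ascents m.+1 j q].
  by apply: contra a_neq => /mapP[t _ [->]].
rewrite /=; have [le_as|] := boolP (all (leq a) s) => //=.
congr [&& _, _ & _]; rewrite addSnnS; have [ja|aj] := ltnP j.+1 a; last first.
  by have -> : (j < a) = false by lia.
rewrite (ltnW ja) /=; congr (_ && _); apply: eq_in_all => b /(allP le_as) ab; lia.
Qed.

Lemma ascents_uniq m j q : uniq (ascents m j q).
Proof.
elim: m j q => [|m IHm] j q; first by case: q.
elim: q => [//|q IHq]; rewrite ascentsSS cat_uniq IHm andbT.
rewrite (map_inj_uniq (can_inj (g := behead) _)) // IHq /=.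
apply/hasPn => s; rewrite mem_ascents => /and3P[_ _ range_s].
by apply/mapP => -[t _ s_eq]; rewrite s_eq /= ltnn in range_s.
Qed.

Lemma prefs_inj n : injective (@prefs n).
Proof.
move=> t u prefs_eq; apply/val_inj.
by apply: (@inj_map _ _ (fun j : 'I_n => j.+1)) prefs_eq => i j [] /val_inj.
Qed.

Lemma prefsP n s : reflect (exists t : n.-tuple 'I_n, s = prefs t)
  ((size s == n) && all (fun a => 0 < a <= n) s).
Proof.
apply: (iffP andP) => [[size_s range_s]|[t ->]]; last first.
  split; first by rewrite size_map size_tuple.
  by apply/allP => x /mapP[i _ ->]; rewrite ltn_ord.
case: n size_s range_s => [|n] size_s range_s.
  by exists [tuple]; case: s size_s {range_s}.
have size_t : size [seq inord a.-1 : 'I_n.+1 | a <- s] == n.+1 by rewrite size_map.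
exists (Tuple size_t); rewrite /prefs /= -map_comp -[LHS]map_id.
by apply/eq_in_map => a /(allP range_s) an /=; rewrite inordK; lia.
Qed.

Lemma card_ascending n (P : pred (seq nat)) :
  #|[set t : n.-tuple 'I_n | ascending t && P (prefs t)]| = count P (ascents n 0 n).
Proof.
rewrite -size_filter cardE -(size_map (@prefs n)).
apply: perm_size; apply: uniq_perm.
- by rewrite (map_inj_uniq (@prefs_inj n)) enum_uniq.
- by rewrite filter_uniq // ascents_uniq.
move=> s; rewrite mem_filter mem_ascents add0n.
apply/mapP/and3P => [[t]|[Ps asc_s /prefsP[t s_eq]]].
  rewrite mem_enum inE => /andP[asc_t Pt] ->; split=> //.
  by apply/prefsP; exists t.
by exists t => //; rewrite mem_enum inE /ascending -s_eq asc_s.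
Qed.

(* Ways to distribute the preferences of the q remaining cars over the m
   remaining spots, when the last r levels were negative; the current level is
   m - q. *)
Fixpoint completions (k m r q : nat) : nat :=
  if m is m'.+1 then
    \sum_(p < q.+1)
      if p <= m' then completions k m' 0 p
      else if r < k then completions k m' r.+1 p else 0
  else q == 0.

Lemma completionsSS k m r q : completions k m.+1 r q.+1 =
  completions k m.+1 r q +
  if q < m then completions k m 0 q.+1
  else if r < k then completions k m r.+1 q.+1 else 0.
Proof. by rewrite [LHS]/= big_ord_recr. Qed.

Lemma completions_no_car k m r : completions k m r 0 = 1.
Proof. by elim: m r => [|m IHm] r //=; rewrite big_ord1 IHm. Qed.

Arguments completions : simpl never.

Lemma completions_forget_run k m r q : q <= m ->
  completions k m.+1 r q = completions k m.+1 0 q.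
Proof.
by move=> qm; apply: eq_bigr => p _; rewrite (leq_trans _ qm) // -ltnS ltn_ord.
Qed.

Lemma count_all_park n k m r j q occ : street r j.+1 occ -> r <= k ->
  j + m = n -> size occ + q = n ->
  count (all_park n k occ) (ascents m j q) = completions k m r q.
Proof.
elim: m r j q occ => [|m IHm] r j q occ; first by case: q.
move=> st rk jm; elim: q occ st => [|q IHq] occ st size_occ.
  by rewrite completions_no_car.
rewrite ascentsSS count_cat count_map completionsSS; congr (_ + _).
  have [||x spot_x st'] := @street_park n k r j.+1 occ st rk; try by lia.
  by rewrite -(IHq (x :: occ)) //=; [apply: eq_count => s; apply: all_park_cons|lia].
have := street_advance st; case: ltnP => [occ_lt|occ_ge] st'; last first.
  by rewrite ifT; [apply: IHm => //|]; lia.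
rewrite ifF; last by lia.
case: ltnP => [lt_rk|kr]; first by apply: IHm => //; lia.
rewrite (eq_in_count (a2 := pred0)) ?count_pred0 // => s.
rewrite mem_ascents => /and3P[_ /eqP size_s range_s].
rewrite (street_stuck st) ?occ_lt // ?size_s; [by lia|by lia|].
by apply: sub_all range_s => b; lia.
Qed.

Lemma I_countE n k : I_count n k = completions k n 0 n.
Proof.
rewrite -(count_all_park (n := n) street_nil) //.
exact: (card_ascending n (all_park n k [::])).
Qed.

Lemma U_countS n k : U_count n.+1 k = completions k n.+1 0 n.
Proof.
have [//|x spot_x street_x] := street_park (n := n.+1) street_nil (leq0n k) isT.
rewrite -(count_all_park (n := n.+1) street_x) //.
pose parks_from1 s := all_park n.+1 k [::] s && (ohead s == Some 1).
rewrite /U_count (card_ascending _ parks_from1).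
rewrite ascentsSS count_cat count_map -[RHS]addn0; congr (_ + _).
  by apply: eq_count => s; rewrite -(all_park_cons s spot_x) /parks_from1 /= andbT.
rewrite (eq_in_count (a2 := pred0)) ?count_pred0 // /parks_from1 => -[|a s].
  by rewrite andbF.
rewrite mem_ascents => /and3P[_ _ /andP[a_gt1 _]].
by apply/andP => -[_ /eqP[a_1]]; rewrite a_1 in a_gt1.
Qed.

(* The levels before the first return to 0 are positive: lowered by 1, and
   without the step that returns to 0, they are those of a 0-Naples preference. *)
Lemma completions_first_return k m q : q <= m ->
  completions k m.+1 0 q =
    \sum_(i < q.+1) completions 0 (m - i) 0 (q - i) * completions k i 0 i.
Proof.
elim: m q => [|m IHm]; elim=> [|q IHq] // qm; rewrite ?big_ord1 ?completions_no_car //.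
rewrite completionsSS qm (IHq (ltnW qm)).
rewrite [RHS]big_ord_recr /= subnn completions_no_car mul1n.
have pascal (i : 'I_q.+1) : completions 0 (m.+1 - i) 0 (q.+1 - i) =
    completions 0 (m.+1 - i) 0 (q - i) +
    if q < m then completions 0 (m - i) 0 (q.+1 - i) else 0.
  have iq := ltn_ord i; rewrite !subSn; try by lia.
  by rewrite completionsSS ltn_sub2rE; last by lia.
under [in RHS]eq_bigr do rewrite pascal mulnDl.
rewrite big_split -addnA; congr (_ + _); case: (ltnP q m) => [q_lt_m|m_le_q].
  by rewrite IHm // big_ord_recr /= subnn completions_no_car mul1n.
have -> : q = m by lia.
by rewrite big1.
Qed.

Lemma U_count_first_return n k :
  U_count n.+1 k = \sum_(i < n.+1) I_count (n - i) 0 * I_count i k.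
Proof.
rewrite U_countS completions_first_return //.
by apply: eq_bigr => i _; rewrite !I_countE.
Qed.

(* Continuations by t further levels, all negative, from level - d. *)
Fixpoint ballot (t d : nat) : nat :=
  if t is t'.+1 then \sum_(e < d.+1) ballot t' e.+1 else 1.

Lemma ballotS0 t : ballot t.+1 0 = ballot t 1.
Proof. by rewrite /= big_ord1. Qed.

Lemma ballotSS t d : ballot t.+1 d.+1 = ballot t.+1 d + ballot t d.+2.
Proof. by rewrite /= big_ord_recr. Qed.

Lemma ballot_bin t d : (t + d).+1 * ballot t d = d.+1 * 'C(2 * t + d, t).
Proof.
elim: t d => [|t IHt] d; first by rewrite bin0.
elim: d => [|d IHd].
  have -> : 2 * t.+1 + 0 = (2 * t + 1).+1 by lia.
  rewrite ballotS0 binS -(@bin_sub (2 * t + 1) t.+1); last by lia.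
  have -> : 2 * t + 1 - t.+1 = t by lia.
  have := IHt 1; lia.
have -> : 2 * t.+1 + d.+1 = (2 * t + d.+2).+1 by lia.
have binE := mul_bin_left (2 * t + d.+2) t.
rewrite (_ : 2 * t + d.+2 - t = (t + d).+2) in binE; last by lia.
rewrite (_ : 2 * t.+1 + d = 2 * t + d.+2) in IHd; last by lia.
rewrite ballotSS binS; apply/eqP; rewrite -(eqn_pmul2l (ltn0Sn (t + d).+1)); apply/eqP.
have := congr1 (muln (t + d).+3) IHd; have := congr1 (muln (t + d).+2) (IHt d.+2).
lia.
Qed.

Lemma ballot_catalan t : ballot t 0 = catalan t.
Proof.
by have := ballot_bin t 0; rewrite !addn0 mul1n /catalan => <-; rewrite mulKn.
Qed.

(* After a run of negative levels the cars in excess fill the spots that the run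
   left empty, and the others form a preference starting with 1. *)
Lemma completions_first_run k m r d : r <= k ->
  completions k m r (m + d) =
    ((m == 0) && (d == 0)) + \sum_(t < (k - r).+1) ballot t d * U_count (m - t) k.
Proof.
elim: m r d => [|m IHm] r d rk.
  by rewrite big1 ?addn0 // => t _; rewrite U_count0 muln0.
have next_level e : (if r < k then completions k m r.+1 (m + e).+1 else 0) =
    \sum_(t < k - r) ballot t e.+1 * U_count (m - t) k.
  case: ltnP => [lt_rk|le_kr]; first by rewrite -addnS IHm // andbF subnSK.
  by rewrite (eqP le_kr) big_ord0.
rewrite add0n; elim: d => [|d IHd]; rewrite big_ord_recl mul1n subn0.
  rewrite addn0 completionsSS ltnn completions_forget_run // -U_countS.
  have := next_level 0; rewrite addn0 => ->; congr (_ + _).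
  by apply: eq_bigr => t _; rewrite lift0 ballotS0.
rewrite addnS completionsSS IHd ifF; last by lia.
rewrite addSnnS next_level big_ord_recl mul1n subn0 -addnA -big_split; congr (_ + _).
by apply: eq_bigr => t _; rewrite lift0 ballotSS mulnDl.
Qed.

Lemma I_count_first_run n k :
  I_count n k = (n == 0) + \sum_(t < k.+1) catalan t * U_count (n - t) k.
Proof.
rewrite I_countE -[X in completions _ _ _ X]addn0 completions_first_run // andbT subn0.
by congr (_ + _); apply: eq_bigr => t _; rewrite ballot_catalan.
Qed.

Import GRing.Theory.
Local Open Scope ring_scope.

Lemma coefXnM_coef0 (R : nzSemiRingType) (p : {poly R}) t n : p`_0 = 0 ->
  ('X^t * p)`_n = p`_(n - t).
Proof.
by move=> p0; rewrite coefXnM; case: ltnP => // /ltnW/eqP ->; rewrite p0.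
Qed.

Lemma coefM_poly (R : nzSemiRingType) (u v : nat -> R) N n : (n < N)%N ->
  ((\poly_(i < N) u i) * \poly_(i < N) v i)`_n = \sum_(i < n.+1) u i * v (n - i)%N.
Proof.
move=> nN; rewrite coefM; apply: eq_bigr => i _.
by rewrite !coef_poly !(leq_ltn_trans _ nN) ?leq_subr // -ltnS.
Qed.

Lemma in_qpolyXnP (R : nzRingType) N (p q : {poly R}) :
  in_qpoly 'X^(N.+1) p = in_qpoly 'X^(N.+1) q <-> forall n, (n <= N)%N -> p`_n = q`_n.
Proof.
have in_qpolyE r : in_qpoly 'X^(N.+1) r = take_poly N.+1 r :> {poly R}.
  by rewrite /= mk_monic_Xn Pdiv.RingMonic.take_poly_rmodp.
split=> [pq n nN|pq].
  have := congr1 (fun r : {poly %/ 'X^(N.+1)} => r`_n) pq.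
  by rewrite !in_qpolyE !coef_take_poly ltnS nN.
apply/val_inj; rewrite [LHS]in_qpolyE [RHS]in_qpolyE; apply/polyP => n.
by rewrite !coef_take_poly ltnS; case: leqP => // /pq.
Qed.

Lemma renewal_eq_perturb (R : comPzRingType) (p c y u u' : R) :
  u = 1 + p * (y * u) -> u' = 1 + (p + c) * (y * u') -> u' = u + c * u * (y * u').
Proof.
move=> uE u'E; have uu'_l : u * u' = u' + p * y * u * u' by rewrite {1}uE; ring.
have uu'_r : u * u' = u + (p + c) * y * u * u' by rewrite {1}u'E; ring.
by apply: (addIr (p * y * u * u')); rewrite -uu'_l uu'_r; ring.
Qed.

Section GeneratingFunctions.

Variable N : nat.

(* Power series are represented modulo 'X^(N.+1). *)
Local Notation trunc := (in_qpoly 'X^(N.+1)).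

Definition gen_series (u : nat -> nat) : {poly %/ ('X^(N.+1) : {poly int})} :=
  trunc (\poly_(i < N.+1) (u i)%:R).

Definition run_poly (k : nat) : {poly int} := \sum_(t < k.+1) (catalan t)%:R *: 'X^t.

Lemma gen_seriesM (u v : nat -> nat) : gen_series u * gen_series v =
  gen_series (fun n => \sum_(i < n.+1) u i * v (n - i))%N.
Proof.
rewrite -in_qpolyM; apply/in_qpolyXnP => n nN; rewrite coefM_poly // coef_poly ltnS nN.
by rewrite natr_sum; apply: eq_bigr => i _; rewrite natrM.
Qed.

Lemma I_series_first_run k : gen_series (I_count^~ k) =
  1 + trunc (run_poly k) * gen_series (U_count^~ k).
Proof.
rewrite -in_qpolyM -(in_qpoly1 'X^(N.+1)) -in_qpolyD; apply/in_qpolyXnP => n nN.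
rewrite coef_poly ltnS nN I_count_first_run natrD natr_sum coefD coef1.
rewrite mulr_suml coef_sum; congr (_ + _); apply: eq_bigr => t _.
rewrite -scalerAl coefZ coefXnM_coef0 ?coef_poly ?U_count0 //.
by rewrite ltnS (leq_trans (leq_subr _ _) nN) natrM.
Qed.

Lemma U_series_first_return k : gen_series (U_count^~ k) =
  trunc 'X * gen_series (I_count^~ 0) * gen_series (I_count^~ k).
Proof.
rewrite -mulrA [gen_series (I_count^~ 0) * _]mulrC gen_seriesM -in_qpolyM.
apply/in_qpolyXnP => -[|n] nN; rewrite coefXM !coef_poly !ltnS nN /=.
  by rewrite U_count0.
rewrite (ltnW nN) U_count_first_return; congr _%:R.
by apply: eq_bigr => i _; rewrite mulnC.
Qed.

Lemma I_series_succ k : gen_series (I_count^~ k.+1) =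
  gen_series (I_count^~ k) +
  trunc ((catalan k.+1)%:R *: 'X^(k.+1)) * gen_series (I_count^~ k) *
    gen_series (U_count^~ k.+1).
Proof.
rewrite U_series_first_return; apply: (renewal_eq_perturb (p := trunc (run_poly k))).
  by rewrite -U_series_first_return -I_series_first_run.
rewrite -in_qpolyD -U_series_first_return {1}I_series_first_run.
by rewrite /run_poly big_ord_recr.
Qed.

Lemma U_series_succ k : gen_series (U_count^~ k.+1) =
  gen_series (U_count^~ k) +
  trunc ((catalan k.+1)%:R *: 'X^(k.+1)) * gen_series (U_count^~ k) *
    gen_series (U_count^~ k.+1).
Proof.
rewrite {1}U_series_first_return I_series_succ (U_series_first_return k).
ring.
Qed.

Lemma coef_renewal_succ (c k n : nat) (u u' v : nat -> nat) :
  gen_series u' =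
    gen_series u + trunc (c%:R *: 'X^k) * gen_series u * gen_series v ->
  v 0%N = 0%N -> (n <= N)%N ->
  u' n = (u n + c * \sum_(i < (n - k).+1) u i * v (n - k - i))%N.
Proof.
rewrite -mulrA gen_seriesM -in_qpolyM -in_qpolyD => /in_qpolyXnP coef_u' v0 nN.
have := coef_u' n nN; rewrite coefD -scalerAl coefZ coefXnM_coef0; last first.
  by rewrite coef_poly big_ord1 v0 muln0.
rewrite !coef_poly !ltnS nN (leq_trans (leq_subr _ _) nN).
by rewrite -natrM -natrD !natz => -[].
Qed.

End GeneratingFunctions.

Local Close Scope ring_scope.

Lemma I_count_succ n k : I_count n k.+1 =
  I_count n k +
  catalan k.+1 * \sum_(i < (n - k.+1).+1) I_count i k * U_count (n - k.+1 - i) k.+1.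
Proof. exact: coef_renewal_succ (I_series_succ n k) (U_count0 _) (leqnn n). Qed.

Lemma U_count_succ n k : U_count n k.+1 =
  U_count n k +
  catalan k.+1 * \sum_(i < (n - k.+1).+1) U_count i k * U_count (n - k.+1 - i) k.+1.
Proof. exact: coef_renewal_succ (U_series_succ n k) (U_count0 _) (leqnn n). Qed.

Theorem theorem5p2 (n k : nat) (hk : 1 <= k <= n - 1) :
  I_count n k =
    I_count n (k - 1)
    + catalan k * \sum_(0 <= i < (n - k).+1) I_count i (k - 1) * U_count (n - k - i) k
  /\
  U_count n k =
    U_count n (k - 1)
    + \sum_(0 <= i < (n - k).+1) U_count i (k - 1) * catalan k * U_count (n - k - i) k.
Proof.
case: k hk => [//|k] _; rewrite subn1 !big_mkord I_count_succ U_count_succ; split=> //.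
by rewrite big_distrr /=; congr (_ + _); apply: eq_bigr => i _; rewrite mulnCA mulnA.
Qed.
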